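(* Let $(X,r)$ be an indecomposable solution whose permutation group $\mathcal{G}(X,r)$ is isomorphic to a (finite) generalized dihedral group of size $2m$. Then the Dehornoy's class $d$ of $(X,r)$ satisfies $d\leq|X|$.
   Context: A solution is a pair $(X,r)$ with $X$ a non-empty set and $r:X\times X\to X\times X$, $r(x,y)=(\sigma_x(y),\tau_y(x))$, such that $(r\times \mathrm{id})(\mathrm{id}\times r)(r\times \mathrm{id})=(\mathrm{id}\times r)(r\times \mathrm{id})(\mathrm{id}\times r)$ on $X^3$, $r^2=\mathrm{id}$ (involutive), and all maps $\sigma_x,\tau_y:X\to X$ are bijections (non-degenerate). The permutation group $\mathcal{G}(X,r)$ is the subgroup of $\mathrm{Sym}(X)$ generated by all $\sigma_x$. $(X,r)$ is indecomposable if $\mathcal{G}(X,r)$ acts transitively on $X$. A group is generalized dihedral if it is a semidirect product $A\rtimes\mathbb{Z}/2\mathbb{Z}$ with $A$ an abelian group on which $\mathbb{Z}/2\mathbb{Z}$ acts by inversion. Dehornoy's class: set $x\cdot y=\sigma_x^{-1}(y)$ and define $\Omega_n:X^n\to X$ by $\Omega_1(x_1)=x_1$ and $\Omega_n(x_1,\dots,x_n)=\Omega_{n-1}(x_1,\dots,x_{n-1})\cdot\Omega_{n-1}(x_1,\dots,x_{n-2},x_n)$ for $n>1$. The Dehornoy's class of $(X,r)$ is the minimal positive integer $d$ such that $\Omega_{d+1}(x,x,\dots,x,y)=y$ for all $x,y\in X$. *)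

(* Defs.v *)
From HB Require Import structures.
From mathcomp Require Import all_boot all_fingroup all_solvable.
From mathcomp Require Import all_classical.

Set Implicit Arguments.
Unset Strict Implicit.
Unset Printing Implicit Defensive.

Local Open Scope classical_set_scope.

Section Solutions.
Variables (X : pointedType) (r : X * X -> X * X).

Definition sigma (x y : X) : X := (r (x, y)).1.
Definition tau (y x : X) : X := (r (x, y)).2.

Definition r_id (t : X * X * X) : X * X * X := (r t.1, t.2).
Definition id_r (t : X * X * X) : X * X * X :=
  let u := r (t.1.2, t.2) in (t.1.1, u.1, u.2).

Definition is_solution : Prop :=
  [/\ r_id \o id_r \o r_id =1 id_r \o r_id \o id_r,
      involutive r,
      forall x, bijective (sigma x)
    & forall y, bijective (tau y)].

(* [pinv setT f] is the two-sided inverse of a bijection [f]. *)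
Definition sym_subgroup (G : set (X -> X)) : Prop :=
  [/\ forall f, G f -> bijective f,
      G idfun,
      forall f g, G f -> G g -> G (f \o g)
    & forall f, G f -> G (pinv [set: X] f)].

Definition permutation_group : set (X -> X) :=
  smallest sym_subgroup (range sigma).

Definition indecomposable : Prop :=
  forall x y : X, exists2 g, permutation_group g & g x = y.

Definition dot (x y : X) : X := pinv [set: X] (sigma x) y.

(* [Omega n] is the operation of arity n + 1, i.e. $\Omega_{n+1}$.  In the
   successor case [lift ord_max] omits the last of the n + 2 arguments and
   [lift (inord n)] omits the last but one. *)
Fixpoint Omega (n : nat) : ('I_n.+1 -> X) -> X :=
  match n with
  | 0 => fun x => x ord0
  | m.+1 => fun x : 'I_m.+2 -> X =>
      dot (Omega (fun i : 'I_m.+1 => x (lift ord_max i)))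
          (Omega (fun i : 'I_m.+1 => x (lift (inord m) i)))
  end.

(* $\Omega_{d+1}(x, \dots, x, y) = y$ for all x, y *)
Definition Omega_trivial (d : nat) : Prop :=
  forall x y : X, @Omega d (fun i => if i == ord_max then y else x) = y.

Definition is_dehornoy_class (d : nat) : Prop :=
  [/\ 0 < d, Omega_trivial d
    & forall k, 0 < k -> Omega_trivial k -> d <= k].

Definition permutation_group_isog (gT : finGroupType) (D : {group gT}) : Prop :=
  exists f : gT -> X -> X,
    [/\ {in D &, forall g h, f (g * h)%g = f g \o f h},
        {in D &, injective f}
      & f @` [set` D] = permutation_group].

End Solutions.

Definition generalized_dihedral (gT : finGroupType) (D : {group gT}) : Prop :=
  exists A K : {group gT},
    [/\ (A ><| K)%g = D, abelian A, #|K| = 2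
      & {in A & K^#%g, forall a k, (a ^ k = a^-1)%g}].

(* Main.v *)
Require Import Defs.
From mathcomp Require Import all_boot all_fingroup all_solvable.
From mathcomp Require Import all_classical.

(** Let G be the permutation group, finite by assumption, and for x in X let
    s x in G be the permutation sigma_x.  For every x consider the map
      shift x : G -> G,   g |-> g * s (g^-1 x).
    In the language of braces this is the additive translation by s x, but
    only four facts about it matter here.
    - The maps [shift x] commute with each other; this is what the first
      coordinate of the braid equation says ([sigma_cycle],
      [shift_fun_comm]).
    - They are bijective and generate a transitive, hence regular, abelian
      group N of permutations of G ([shift_fun_inj], [shift_orbit1],
      [card_shift_group]).
    - Left multiplication by g conjugates [shift x] to [shift (g x)]
      ([shift_conj]), so when G is transitive on X all shifts have the same
      order d, and d divides #|N| = #|G|.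
    - The n-th iterate of [shift x] sends 1 to
      s x * s (T x) * ... * s (T^(n-1) x), where T z = (s z)^-1 z, and
      Omega_(n+1) (x, ..., x, y) is the image of y under the inverse of this
      product ([Omega_word]).  By regularity, the product is trivial exactly
      when d divides n.  Hence d is the Dehornoy class.

    If d = #|G|, every shift generates N.  An element fixing x commutes, as a
    left multiplication, with [shift x], hence with the regular abelian group
    N, hence it belongs to N.  All point stabilisers therefore embed into the
    cyclic group N as subgroups of one and the same order, so they coincide,
    and faithfulness makes them trivial: #|X| = #|G| = d ([stab_trivial]).

    Otherwise d is a proper divisor of #|G|, so d <= #|G| / 2 = #|A|, where A
    is the abelian part of the generalized dihedral group G.  Being abelian
    and having all its subgroups normal in G, A acts freely on X
    ([dihedral_free]), whence #|A| <= #|X|. *)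

Set Implicit Arguments.
Unset Strict Implicit.
Unset Printing Implicit Defensive.

Local Open Scope classical_set_scope.
Local Open Scope card_scope.

(** * The regular abelian group of shifts *)

Section Shifts.
Local Open Scope group_scope.

Variables (G : finGroupType) (X : Type) (act : G -> X -> X) (s : X -> G).
Hypothesis act1 : forall x, act 1 x = x.
Hypothesis actM : forall g h x, act (g * h) x = act g (act h x).
Hypothesis act_trans : forall x y, exists g, act g x = y.
Hypothesis s_gen : <<[set h | `[< exists x, h = s x >]]%SET>> = [set: G]%SET.
Hypothesis s_cycle : forall x y,
  s x * s (act (s x)^-1 y) = s y * s (act (s y)^-1 x).

Lemma actK g : cancel (act g) (act g^-1).
Proof. by move=> x; rewrite -actM mulVg. Qed.

Lemma actVK g : cancel (act g^-1) (act g).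
Proof. by move=> x; rewrite -actM mulgV. Qed.

(** Inverses in a finite group are positive powers, so that every element is a
    product of generators. *)
Lemma closed_full (I : {set G}) g0 :
  g0 \in I -> (forall g x, g \in I -> g * s x \in I) -> I = [set: G]%SET.
Proof.
move=> Ig0 clI; apply/eqP; rewrite finset.eqEsubset finset.subsetT /=.
apply/fintype.subsetP => g _.
have : g0^-1 * g \in [set: G]%SET by rewrite inE.
rewrite -s_gen => /gen_prodgP[n [c cP eq_c]].
suff /(_ g0 Ig0) : forall h, h \in I -> h * \prod_(i < n) c i \in I.
  by rewrite -eq_c mulKVg.
elim/big_ind: _ => [h|u v IHu IHv h Ih|i _ h Ih]; first by rewrite mulg1.
- by rewrite mulgA; apply: IHv; apply: IHu.
- by have := cP i; rewrite inE => /asboolP[x ->]; apply: clI.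
Qed.

(** Addition of [s x] to [g] in the brace structure of [G]. *)
Definition shift_fun x g := g * s (act g^-1 x).

Lemma shift_fun_comm x y g :
  shift_fun x (shift_fun y g) = shift_fun y (shift_fun x g).
Proof.
by rewrite /shift_fun !invMg !actM -!mulgA; congr (_ * _); apply: s_cycle.
Qed.

(** Additive translations are permuted by left multiplication, along the
    action on [X]. *)
Lemma shift_funM x h g : h * shift_fun x g = shift_fun (act h x) (h * g).
Proof. by rewrite /shift_fun invMg actM actK mulgA. Qed.

(** Every right multiplication by a generator is, at a given point, a shift:
    this is how [closed_full] yields transitivity. *)
Lemma shift_fun_step g x : g * s x = shift_fun (act g x) g.
Proof. by rewrite /shift_fun actK. Qed.

(** Since the shifts commute, the image of one of them is stable under all
    the others, hence is all of [G]; a surjection of a finite set onto itself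
    is injective. *)
Lemma shift_fun_inj x : injective (shift_fun x).
Proof.
have im_full : (shift_fun x @: [set: G])%SET = [set: G]%SET.
  apply: (@closed_full _ (shift_fun x 1)) => [|_ y /imsetP[g _ ->]].
    exact: imset_f.
  by rewrite shift_fun_step shift_fun_comm imset_f.
have /imset_injP inj : #|(shift_fun x @: [set: G])%SET| == #|[set: G]%SET|.
  by rewrite im_full.
by move=> g h; apply: inj; rewrite inE.
Qed.

Definition shift x : {perm G} := perm (@shift_fun_inj x).

(** Inverting [g] makes [ltrans] a morphism, since permutations are composed
    from left to right. *)
Definition ltrans g : {perm G} := perm (mulgI g^-1).

Lemma shift_conj x g : shift x ^ ltrans g = shift (act g^-1 x).
Proof.
apply/permP => h; rewrite -{1}(mulKg g h) -[g^-1 * (g * h)](permE (mulgI g^-1)).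
by rewrite permJ !permE shift_funM mulKg.
Qed.

Lemma ltransM g h : ltrans (g * h) = ltrans g * ltrans h.
Proof. by apply/permP => k; rewrite permM !permE invMg mulgA. Qed.

Lemma ltransX g n : ltrans (g ^+ n) = ltrans g ^+ n.
Proof.
elim: n => [|n IHn]; last by rewrite !expgS ltransM IHn.
by apply/permP => k; rewrite !permE invg1 mul1g.
Qed.

Lemma ltransJ g h : ltrans (g ^ h) = ltrans g ^ ltrans h.
Proof. by apply: (mulgI (ltrans h)); rewrite -conjgC -!ltransM -conjgC. Qed.

Lemma ltrans_inj : injective ltrans.
Proof.
move=> g h /permP/(_ 1); rewrite !permE !mulg1; exact: invg_inj.
Qed.

Definition shift_group := <<[set p | `[< exists x, p = shift x >]]%SET>>%G.

Lemma mem_shift x : shift x \in shift_group.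
Proof. by apply: mem_gen; rewrite inE; apply/asboolP; exists x. Qed.

Lemma shift_abelian : abelian shift_group.
Proof.
rewrite abelian_gen; apply/fintype.subsetP => p; rewrite inE => /asboolP[x ->].
apply/centP => q; rewrite inE => /asboolP[y ->].
by apply/permP => g; rewrite !permM !permE shift_fun_comm.
Qed.

Lemma shift_orbit1 :
  ((fun p : {perm G} => p 1) @: shift_group)%SET = [set: G]%SET.
Proof.
apply: (@closed_full _ 1) => [|_ x /imsetP[p Np ->]].
  by apply/imsetP; exists 1; rewrite ?group1 ?perm1.
rewrite shift_fun_step; set y := act _ _; apply/imsetP.
by exists (p * shift y); rewrite ?permM ?permE // groupM ?mem_shift.
Qed.

Lemma shift_transitive g : exists2 p, p \in shift_group & p 1 = g.
Proof.
have : g \in [set: G]%SET by rewrite inE.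
by rewrite -shift_orbit1 => /imsetP[p Np ->]; exists p.
Qed.

(** Two permutations commuting with a transitive group agree everywhere as soon
    as they agree at one point. *)
Lemma shift_semiregular p q :
  p \in shift_group -> q \in 'C(shift_group) -> p 1 = q 1 -> p = q.
Proof.
move=> Np cNq eq_pq; apply/permP => g; have [t Nt <-] := shift_transitive g.
rewrite -!permM -(centP cNq t Nt) (centsP shift_abelian t Nt p Np).
by rewrite !permM eq_pq.
Qed.

(** A regular abelian permutation group is its own centraliser. *)
Lemma shift_cent : 'C(shift_group) = shift_group.
Proof.
apply/eqP; rewrite finset.eqEsubset; apply/andP; split; last first.
  exact: shift_abelian.
apply/fintype.subsetP => q cNq; have [p Np p1] := shift_transitive (q 1).
by rewrite -(shift_semiregular Np cNq p1).
Qed.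

Lemma card_shift_group : #|shift_group| = #|G|.
Proof.
rewrite -cardsT -shift_orbit1 card_in_imset // => p q Np Nq.
by apply: shift_semiregular; rewrite ?shift_cent.
Qed.

Lemma order_shift x y : #[shift x] = #[shift y].
Proof.
have [g <-] := act_trans y x.
by rewrite -[g]invgK -shift_conj orderJ.
Qed.

Lemma order_shift_dvd x : #[shift x] %| #|G|.
Proof. by rewrite -card_shift_group; apply/order_dvdG/mem_shift. Qed.

(** This is s x * s (T x) * ... * s (T^(n-1) x) with T z = (s z)^-1 z: the
    [n]-th additive multiple of [s x]. *)
Definition word x n := iter n (shift_fun x) 1.

(** By semiregularity a power of [shift x] is trivial as soon as it
    fixes 1. *)
Lemma word1P x n : (word x n = 1) <-> (#[shift x] %| n).
Proof.
have wordE : word x n = (shift x ^+ n) 1.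
  by rewrite permX; apply: eq_iter => g; rewrite permE.
rewrite order_dvdn wordE; split => [w1|/eqP ->]; last by rewrite perm1.
apply/eqP/shift_semiregular; rewrite ?groupX ?mem_shift ?group1 //.
by rewrite w1 perm1.
Qed.

Section Cyclic.
Hypothesis act_faithful : forall g, (forall x, act g x = x) -> g = 1.
Variable x : X.
Hypothesis shift_full : #[shift x] = #|G|.

(** If [g] fixes [y] then [ltrans g] commutes with [shift y], which here
    generates the self-centralising group of all shifts. *)
Lemma ltrans_stab y g : act g y = y -> ltrans g \in shift_group.
Proof.
move=> gy; rewrite -shift_cent.
have -> : shift_group = <[shift y]>%G.
  apply/eqP; rewrite eq_sym -val_eqE eqEcard /= cycle_subG mem_shift.
  by rewrite [#|_|]card_shift_group -shift_full (order_shift x y) /=.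
rewrite cent_cycle; apply/cent1P/commute_sym/commgP/conjg_fixP.
by rewrite shift_conj -{1}gy actK.
Qed.

(** The stabilisers of any two points are conjugate and lie, through [ltrans],
    in one cyclic group, where the order determines the subgroup.  So an
    element fixing one point fixes them all. *)
Lemma stab_trivial g : act g x = x -> g = 1.
Proof.
move=> gx; apply: act_faithful => y; have [k <-] := act_trans x y.
have Ng := ltrans_stab gx.
have gky : act (g ^ k) (act k^-1 x) = act k^-1 x.
  by rewrite -actM conjgE -!mulgA mulgV mulg1 actM gx.
have Ngk := ltrans_stab gky.
have Ncyc : cyclic shift_group.
  apply/cyclicP; exists (shift x); apply/eqP.
  rewrite eq_sym eqEcard cycle_subG mem_shift /=.
  by rewrite [#|_|]card_shift_group -shift_full.
(* The conjugate of [g] fixing [k^-1 x] is thus a power of [g]. *)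
have : <[ltrans (g ^ k)]> == <[ltrans g]>.
  by rewrite (eq_subG_cyclic Ncyc) ?cycle_subG // -!orderE ltransJ orderJ.
move=> /eqP eq_cyc; have : ltrans (g ^ k) \in <[ltrans g]>.
  by rewrite -eq_cyc cycle_id.
move=> /cycleP[i]; rewrite -ltransX => /ltrans_inj gkE.
rewrite -actM conjgC gkE actM; congr (act k _).
by elim: i {gkE} => [|i IHi]; rewrite ?act1 // expgS actM IHi.
Qed.

End Cyclic.
End Shifts.

(** * From solutions to shifts *)

(** With u = sigma_x^-1 y and v = sigma_y^-1 x this is the cycle set identity.
    Involutivity gives v = tau_u x, after which the identity is the first
    coordinate of the braid equation at (x, u, z). *)
Lemma sigma_cycle (X : pointedType) (r : X * X -> X * X) (x y u v z : X) :
  is_solution r -> sigma r x u = y -> sigma r y v = x ->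
  sigma r x (sigma r u z) = sigma r y (sigma r v z).
Proof.
case=> ybe rK sigma_bij _ xu yv.
have ryx : r (x, u) = (y, tau r u x).
  by rewrite -xu /sigma /tau -surjective_pairing.
have -> : v = tau r u x.
  apply: (bij_inj (sigma_bij y)); rewrite yv.
  by rewrite {1}/sigma -ryx rK.
have /(congr1 (fun t => t.1.1)) := ybe (x, u, z).
by rewrite /r_id /id_r /= ryx /= => /esym.
Qed.

Section Realisation.
Local Open Scope group_scope.

Variables (X : pointedType) (r : X * X -> X * X).
Variables (G : finGroupType) (act : G -> X -> X) (s : X -> G).
Hypothesis act1 : forall x, act 1 x = x.
Hypothesis actM : forall g h x, act (g * h) x = act g (act h x).
Hypothesis act_s : forall x, act (s x) = sigma r x.

Lemma pinv_act g : pinv [set: X] (act g) = act g^-1.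
Proof.
apply/funext => y.
have inj : {in [set: X] &, injective (act g)}.
  by move=> x z _ _; apply: can_inj (actK act1 actM g) _ _.
by rewrite -{1}(actVK act1 actM g y) pinvKV ?in_setT.
Qed.

(** Write w for [word act s x n].  By induction one more step of the recursion
    applies the inverse of s (w^-1 x) after w^-1, and the result is the inverse
    of w * s (w^-1 x), that is, of the shift of w. *)
Lemma Omega_word n x y :
  @Omega X r n (fun i => if i == ord_max then y else x)
  = act (word act s x n)^-1 y.
Proof.
elim: n x y => [|n IHn] x y; first by rewrite /= invg1 act1.
rewrite /= /dot -act_s pinv_act.
set a := Omega _ _; set b := Omega _ _.
(* The first argument of [dot] is the case y = x of the induction hypothesis. *)
have -> : a = act (word act s x n)^-1 x.
  rewrite -IHn /a; congr Omega; apply/funext => i.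
  by rewrite eq_sym (negPf (neq_lift _ _)) if_same.
have -> : b = act (word act s x n)^-1 y.
  rewrite -IHn /b; congr Omega; apply/funext => i; congr (if _ then _ else _).
  rewrite -!val_eqE /= /bump inordK //.
  have := ltn_ord i; rewrite ltnS leq_eqVlt => /orP[/eqP ->|lt_in].
    by rewrite leqnn add1n !eqxx.
  by rewrite leqNgt lt_in add0n !ltn_eqF // ltnS ltnW.
by rewrite /shift_fun invMg actM.
Qed.

Lemma Omega_trivialE n :
  (forall g, (forall x, act g x = x) -> g = 1) ->
  Omega_trivial r n <-> forall x, word act s x n = 1.
Proof.
move=> faithful; split => [triv x|w1 x y]; last first.
  by rewrite Omega_word w1 invg1 act1.
apply: invg_inj; rewrite invg1; apply: faithful => y.
by rewrite -Omega_word triv.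
Qed.

(** The set of permutations coming from the subgroup generated by the [s x]
    is closed under the group operations and contains every sigma_x. *)
Lemma s_generates :
  injective act -> permutation_group r = range act ->
  <<[set h | `[< exists x, h = s x >]]%SET>> = [set: G]%SET.
Proof.
move=> act_inj act_im; set K := <<_>>.
have sub : permutation_group r `<=` act @` [set` K].
  apply: smallest_sub => [|_ [x _ <-]]; last first.
    exists (s x) => //=.
    by apply: mem_gen; rewrite inE; apply/asboolP; exists x.
  split=> [_ [g _ <-]||_ _ [g Kg <-] [h Kh <-]|_ [g Kg <-]].
  - by exists (act g^-1); [apply: actK | apply: actVK].
  - by exists 1; [rewrite /= group1 | apply/funext => x; rewrite act1].
  - by exists (g * h); [rewrite /= groupM | apply/funext => x; rewrite actM].
  - by exists g^-1; [rewrite /= groupV | rewrite pinv_act].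
apply/setP => g; rewrite inE.
have [h Kh /act_inj <-] : (act @` [set` K]) (act g).
  by apply: sub; rewrite act_im; exists g.
exact: Kh.
Qed.

End Realisation.

(** * Counting *)

Lemma card_le_inj (T : finType) (X : pointedType) (B : {set T}) (f : T -> X) d :
  {in B &, injective f} -> d <= #|B| -> `I_d #<= [set: X].
Proof.
move=> f_inj le_dB; have [B0|[t0 Bt0]] := set_0Vmem B.
  move: le_dB; rewrite B0 cards0 leqn0 => /eqP ->.
  by rewrite II0; apply: card_ge0.
apply/pcard_injP; exists (fun i => f (nth t0 (enum B) i)) => i j.
rewrite !inE /= => lt_id lt_jd.
have ltB k : k < d -> k < size (enum B).
  by move=> lt_kd; rewrite -cardE (leq_trans lt_kd).
have memB k : k < d -> nth t0 (enum B) k \in B.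
  by move=> /ltB; rewrite -[_ \in B]mem_enum; apply: mem_nth.
move=> /f_inj => /(_ (memB _ lt_id) (memB _ lt_jd))/eqP.
by rewrite nth_uniq ?enum_uniq ?ltB // => /eqP.
Qed.

(** Suppose that [a] in [A] fixes [x].  Every point is b k x with [b] in [A]
    and [k] in [K], and a b k x = b a k x = b k (a^k) x, where a^k is [a] or its
    inverse and therefore fixes [x] too.  So [a] fixes every point. *)
Lemma dihedral_free (gT : finGroupType) (A K D : {group gT}) (X : Type)
    (act : gT -> X -> X) :
  (A ><| K = D)%g -> abelian A -> #|K| = 2 ->
  {in A & K^#%g, forall a k, a ^ k = a^-1}%g ->
  {in D &, forall g h x, act (g * h)%g x = act g (act h x)} ->
  {in D, forall g, (forall x, act g x = x) -> g = 1%g} ->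
  (forall x y, exists2 g, g \in D & act g x = y) ->
  forall x, {in A &, injective (fun a => act a x)}.
Proof.
move=> defD cAA cardK invK actM faithful trans x.
have [_ defAK _ _] := sdprodP defD.
have /andP[sAD sKD] : (A \subset D) && (K \subset D).
  by rewrite -defAK mulG_subl mulG_subr.
have AD a : a \in A -> a \in D by exact: (fintype.subsetP sAD).
have KD k : k \in K -> k \in D by exact: (fintype.subsetP sKD).
have act1 z : act 1%g z = z.
  have [g Dg <-] := trans z z; by rewrite -actM ?mul1g.
have stab1 a : a \in A -> act a x = x -> a = 1%g.
  move=> Aa ax; apply: faithful => [|y]; first exact: AD.
  have [g] := trans x y; rewrite -defAK => /mulsgP[b k Ab Kk ->] <-.
  have aVx : act a^-1%g x = x by rewrite -{1}ax -actM ?groupV ?AD // mulVg act1.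
  have ak : exists2 c, c \in A & (a * k = k * c)%g /\ act c x = x.
    have [->|k1] := eqVneq k 1%g; first by exists a; rewrite // mulg1 mul1g.
    exists a^-1%g; rewrite ?groupV //; split=> //.
    by rewrite -(invK a k) ?inE ?k1 // -conjgC.
  have [c Ac [akE cx]] := ak.
  have [Da Db Dc Dk] := And4 (AD a Aa) (AD b Ab) (AD c Ac) (KD k Kk).
  have -> : act a (act (b * k)%g x) = act (a * (b * k))%g x.
    by rewrite -actM // groupM.
  rewrite mulgA (centsP cAA a Aa b Ab) -mulgA akE mulgA.
  by rewrite actM ?groupM // cx.
move=> a b Aa Ab /= eq_ab; apply/eqP; rewrite eq_sym eq_mulVg1; apply/eqP.
apply: stab1; first by rewrite groupM ?groupV.
by rewrite actM ?groupV ?AD // eq_ab -actM ?groupV ?AD // mulVg act1.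
Qed.

Theorem proposition5p17 (X : pointedType) (r : X * X -> X * X) (m : nat)
    (gT : finGroupType) (D : {group gT}) :
  is_solution r ->
  indecomposable r ->
  generalized_dihedral D ->
  #|D| = (2 * m)%N ->
  permutation_group_isog r D ->
  exists2 d : nat, is_dehornoy_class r d & `I_d #<= [set: X].
Proof.
move=> sol indec [A [K [defD cAA cardK invK]]] _ [f [fM f_inj f_im]].
have fT x y : exists2 g, g \in D & f g x = y.
  have [g] := indec x y; rewrite -f_im => -[h Dh <-] hx; by exists h.
have fMx : {in D &, forall g h x, f (g * h)%g x = f g (f h x)}.
  by move=> g h Dg Dh x; rewrite fM.
have f1 x : f 1%g x = x.
  by have [g Dg <-] := fT x x; rewrite -fMx ?mul1g.
have f_faithful : {in D, forall g, (forall x, f g x = x) -> g = 1%g}.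
  move=> g Dg gx; apply: f_inj => //; apply/funext => x; by rewrite gx f1.
(* [f] is a morphism on [D] only, so [D] is turned into a group type. *)
pose act (g : subg_of D) := f (sgval g).
have act1 x : act 1%g x = x by exact: f1.
have actM g h x : act (g * h)%g x = act g (act h x).
  by apply: fMx; apply: subgP.
have actT x y : exists g, act g x = y.
  by have [g Dg gx] := fT x y; exists (subg D g); rewrite /act subgK.
have act_inj : injective act.
  by move=> g h /f_inj eq_gh; apply: val_inj; apply: eq_gh; apply: subgP.
have faithful g : (forall x, act g x = x) -> g = 1%g.
  by move=> gx; apply: act_inj; apply/funext => x; rewrite gx act1.
have act_im : permutation_group r = range act.
  rewrite -f_im; apply/seteqP; split=> [_ [g Dg <-]|_ [g _ <-]].
    by exists (subg D g); rewrite // /act subgK.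
  by exists (sgval g) => //=; apply: subgP.
have /choice[s act_s] x : exists g, act g = sigma r x.
  have [g _ gE] : range act (sigma r x).
    by rewrite -act_im; apply: sub_gen_smallest; exists x.
  by exists g.
have s_gen := s_generates act1 actM act_s act_inj act_im.
have s_cycle x y : (s x * s (act (s x)^-1 y) = s y * s (act (s y)^-1 x))%g.
  apply: act_inj; apply/funext => z; rewrite !actM !act_s.
  by apply: sigma_cycle => //; rewrite -act_s actVK.
pose x0 : X := point.
pose d := #[shift act1 actM s_gen s_cycle x0]%g.
have wordE := word1P act1 actM s_gen s_cycle.
have trivE n : Omega_trivial r n <-> (d %| n)%N.
  rewrite (Omega_trivialE act1 actM act_s n faithful); split=> [w1|dn x].
    by apply/wordE.
  by apply/wordE; rewrite (order_shift act1 actM actT s_gen s_cycle x x0).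
exists d.
  split=> [||k k_gt0 /trivE/dvdn_leq]; [exact: order_gt0 | exact/trivE | exact].
have cardG : #|subg_of D| = #|D| by rewrite card_sub.
have d_dvd : (d %| #|D|)%N by rewrite -cardG; apply: order_shift_dvd.
have [dG|dG] := eqVneq d #|D|.
  apply: (@card_le_inj _ _ [set: subg_of D]%SET (act^~ x0)); last first.
    by rewrite cardsT cardG dG.
  move=> g h _ _ /= gh; apply/eqP; rewrite eq_sym eq_mulVg1; apply/eqP.
  apply: (@stab_trivial _ _ _ _ act1 actM actT s_gen s_cycle faithful x0).
    by rewrite cardG -dG.
  by rewrite actM gh actK.
have A_free := dihedral_free defD cAA cardK invK fMx f_faithful fT (x := x0).
apply: (card_le_inj A_free).
(* Here d is a proper divisor of #|D| = 2 #|A|. *)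
have cardAK := sdprod_card defD.
have /dvdnP[q qE] := d_dvd.
have q_ge2 : 1 < q.
  case: q qE => [|[|q]] // qE; first by have := cardG_gt0 D; rewrite qE.
  by rewrite qE mul1n eqxx in dG.
rewrite -(leq_pmul2r (m := 2)) //.
by rewrite -{2}cardK cardAK qE mulnC leq_mul2r q_ge2 orbT.
Qed.
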